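(* For every integer $m\geq 3$ and every positive integer $n$, every $m$-dimensional $n$-colorable map is a cross-section of an $(m+1)$-dimensional $K^n$.
   Context: Definitions. An $m$-dimensional region is a non-empty connected open set of dimension $m$ together with its boundary (the closure of a non-empty connected open subset of $\mathbb R^m$). Two $m$-dimensional regions are adjacent if they share a non-empty $(m-1)$-dimensional region; sharing only a set of dimension at most $m-2$ does not count as adjacency. An $m$-dimensional map is a splitting of $\mathbb R^m$ into any number of $m$-dimensional regions, distinct regions having disjoint underlying open sets. A map is $n$-colorable if its regions can be colored with at most $n$ colors so that adjacent regions receive different colors. An $m$-dimensional $K^n$ is a family of $n$ $m$-dimensional regions in $\mathbb R^m$ with pairwise disjoint underlying open sets that are pairwise adjacent (it need not fill $\mathbb R^m$). An $m$-dimensional map $M$ is a cross-section of a family $(Y_i)$ of $(m+1)$-dimensional regions if, identifying $\mathbb R^m$ with the hyperplane $\{x_{m+1}=0\}$ of $\mathbb R^{m+1}$, each region of $M$ can be assigned an index $i$ so that for every $i$ the set $Y_i\cap\{x_{m+1}=0\}$ is the union of the regions of $M$ assigned to $i$ (possibly empty), and two distinct regions of $M$ assigned to the same $i$ are not adjacent (adjacent pieces of the same $Y_i$ count as one region).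
   Formalization: Maps are assumed locally finite (each point has a neighbourhood meeting finitely many regions). For arbitrary infinite maps the claim fails for n ≥ 2: take {x_1≤0}, {x_1≥1} and the slabs {1/(k+1)≤x_1≤1/k}. *)

(* Defs.v *)
From HB Require Import structures.
From mathcomp Require Import all_boot all_order all_algebra.
From mathcomp Require Import all_classical all_reals all_analysis.

Set Implicit Arguments.
Unset Strict Implicit.
Unset Printing Implicit Defensive.

Import Order.TTheory GRing.Theory Num.Theory.
Import numFieldNormedType.Exports.
Local Open Scope classical_set_scope.
Local Open Scope ring_scope.

(* R^m is 'rV[R]_m.  Disjointness of regions refers to their underlying open
   sets, so a region is represented by that open set U; the region itself, as
   a set of points, is closure U. *)
Definition region_interior (R : realType) (m : nat) (U : set 'rV[R]_m) : Prop :=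
  [/\ U !=set0, open U & connected U].

(* S, a subset of R^d, is a (possibly curved) k-dimensional region: the image
   of the closure of a non-empty connected open subset of R^k under a
   homeomorphism f onto S, with inverse g. *)
Definition is_region_in (R : realType) (k d : nat) (S : set 'rV[R]_d) : Prop :=
  exists (W : set 'rV[R]_k) (f : 'rV[R]_k -> 'rV[R]_d) (g : 'rV[R]_d -> 'rV[R]_k),
    [/\ region_interior W,
        f @` closure W = S,
        (forall w, closure W w -> g (f w) = w),
        {within closure W, continuous f}
      & {within S, continuous g}].

Definition adjacent (R : realType) (m : nat) (U V : set 'rV[R]_m) : Prop :=
  exists2 S : set 'rV[R]_m,
    is_region_in m.-1 S & S `<=` closure U `&` closure V.

Definition locally_finite (T : topologicalType) (I : Type) (F : I -> set T) :
    Prop :=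
  forall x : T, exists2 N : set T,
    nbhs x N & finite_set [set i | F i `&` N !=set0].

(* The splitting may have finitely or infinitely many regions, but is locally
   finite.  Without this the union of the regions of one color need not be
   closed, whereas a hyperplane section of a region always is: split R^m into
   {x_1 <= 0}, {x_1 >= 1} and the slabs {1/(k+2) <= x_1 <= 1/(k+1)}.  This is
   2-colorable, but any admissible assignment of indices has two indices whose
   sets accumulate on {x_1 = 0}, and only one of them contains {x_1 <= 0}. *)
Definition is_map (R : realType) (m : nat) (I : Type) (M : I -> set 'rV[R]_m) :
    Prop :=
  [/\ (forall r, region_interior (M r)),
      trivIset [set: I] M,
      \bigcup_r closure (M r) = [set: 'rV[R]_m]
    & locally_finite (fun r => closure (M r))].

Definition colorable (R : realType) (m n : nat) (I : Type)
    (M : I -> set 'rV[R]_m) : Prop :=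
  exists c : I -> 'I_n,
    forall r s : I, r <> s -> adjacent (M r) (M s) -> c r <> c s.

Definition is_K (R : realType) (m n : nat) (Y : 'I_n -> set 'rV[R]_m) : Prop :=
  [/\ (forall i, region_interior (Y i)),
      trivIset [set: 'I_n] Y
    & forall i j : 'I_n, i <> j -> adjacent (Y i) (Y j)].

Definition hyperplane (R : realType) (m : nat) : set 'rV[R]_(m + 1) :=
  [set y | rsubmx y = 0].

Definition to_hyperplane (R : realType) (m : nat) (x : 'rV[R]_m) :
    'rV[R]_(m + 1) :=
  row_mx x 0.

Definition cross_section (R : realType) (m : nat) (I J : Type)
    (M : I -> set 'rV[R]_m) (Y : J -> set 'rV[R]_(m + 1)) : Prop :=
  exists a : I -> J,
    (forall i : J, closure (Y i) `&` @hyperplane R m =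
       @to_hyperplane R m @` (\bigcup_(r in [set r | a r = i]) closure (M r))) /\
    (forall r s : I, r <> s -> a r = a s -> ~ adjacent (M r) (M s)).

(* Main.v *)
Require Import Defs.
From mathcomp Require Import all_boot all_order all_algebra.
From mathcomp Require Import all_classical all_reals all_analysis.
From mathcomp Require Import lra.

Set Implicit Arguments.
Unset Strict Implicit.
Unset Printing Implicit Defensive.

Import Order.TTheory GRing.Theory Num.Theory.
Import numFieldNormedType.Exports.
Local Open Scope classical_set_scope.
Local Open Scope ring_scope.

(** Let [c] be a coloring of the map [M] with [n] colors.  The [n] regions of
R^(m+1) are built by thickening the regions of [M] and joining the pieces of
one color above the hyperplane, where one more dimension leaves room.

Write a point of R^(m+1) as [(x, t)].  Inside every region [M r] choose [n]
disjoint cubes, one for each color, with room around each of them.  The body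
of color [i] is the union of
- the slabs [M r x (-1, 1)] for the regions [r] of color [i] ([base]);
- for every region [r], a vertical tube over the cube of [r] of color [i],
  ending at height [i + 2]; it begins at height [0] if [r] has color [i], so
  that it is rooted in the slab over [r], and at height [1] otherwise, so that
  it avoids that slab;
- the layer [R^m x (i + 1, i + 2)] with the closed tubes of the colors [j > i]
  removed.

Near [t = 0] the body is the product of an open interval with the union of the
regions of color [i], and local finiteness makes the union of their closures
closed; this gives the cross-section ([closure_body_hyperplane]).  The bodies
are disjoint because the tubes of color [j < i] stop below layer [i] and those
of color [j > i] have been removed from it ([trivIset_body]).  For [i < j] a
side wall of a tube of color [j] inside layer [i] lies in the closure of both
bodies, and it contains an [m]-dimensional box ([adjacent_body]).

It remains to see that a body is connected ([connected_body]).  Each tube and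
each slab is connected and leads to the layer, so what matters is that R^m
stays connected when a closed union of separated cubes is removed.  This is
[connected_setC_cubes]: a separation of the complement would extend over each
cube, because the shell around a cube is connected when [m >= 2]
([connected_annulus]), and R^m is connected. *)

(** * Connectedness, locally finite unions and closures *)

Section Topology.
Variable T : topologicalType.
Implicit Types A B C : set T.

(** Membership in a common connected component is transitive, so a set can be
proved connected by leading each of its points to [x] through a chain of
connected pieces. *)
Lemma connected_joined A x :
  (forall y, A y -> connected_component A x y) -> connected A.
Proof.
move=> Ax; have -> : A = connected_component A x.
  by apply/seteqP; split => // y; exact: connected_component_sub.
exact: component_connected.
Qed.

Lemma joined_in A B x y :
  connected B -> B `<=` A -> B x -> B y -> connected_component A x y.
Proof. by move=> cB BA Bx By; exists B. Qed.

(** A subset [B] that is clopen in [U] contains or misses each connected set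
[N k `&` U].  Adding to [B] the [N k] whose trace it contains, and the other
[N k] to the rest of [U], splits the whole space into two disjoint open
sets. *)
Lemma connected_fill (K : Type) (D : set K) (N : K -> set T) U :
    connected [set: T] -> open U -> (forall k, D k -> open (N k)) ->
    trivIset D N -> (forall k, D k -> connected (N k `&` U)) ->
    U `|` \bigcup_(k in D) N k = [set: T] ->
  connected U.
Proof.
move=> cT oU oN tN cNU cov B [b Bb] [C oC BUC] [F cF BUF].
have BU x : B x -> U x by rewrite BUC => -[].
have oB : open B by rewrite BUC; exact: openI.
have oUB : open (U `\` B).
  rewrite (_ : _ `\` _ = U `&` ~` F); first exact/openI/closed_openC.
  apply/seteqP; split => x [Ux nx]; split => // Fx; apply: nx.
    by rewrite BUF.
  by move: Fx; rewrite BUF => -[].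
have NB k : D k -> (N k `&` B !=set0) -> N k `&` U `<=` B.
  move=> Dk [x [Nx Bx]]; have /= <- := cNU k Dk (N k `&` B); first by move=> ? [].
  - by exists x.
  - by exists C => //; rewrite BUC setIA.
  - by exists F => //; rewrite BUF setIA.
pose P := B `|` \bigcup_(k in [set k | D k /\ N k `&` B !=set0]) N k.
pose Q := (U `\` B) `|` \bigcup_(k in [set k | D k /\ ~ (N k `&` B !=set0)]) N k.
have oP : open P by apply: openU => //; apply: bigcup_open => k [] /oN.
have oQ : open Q by apply: openU => //; apply: bigcup_open => k [] /oN.
have PQ x : P x -> Q x -> False.
  case=> [Bx|[k [Dk NkB] Nkx]]; case=> [[Ux nBx]//|[l [Dl NlB] Nlx]].
  - by apply: NlB; exists x.
  - by apply: nBx; apply: NB NkB _ _.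
  - have E := tN k l Dk Dl; apply: NlB; rewrite -E //.
    by exists x.
have PQT x : P x \/ Q x.
  have : [set: T] x by [].
  rewrite -cov => -[Ux|[k Dk Nx]].
    by have [Bx|nBx] := pselect (B x); [left; left|right; left].
  have [NkB|NkB] := pselect (N k `&` B !=set0).
    by left; right; exists k.
  by right; right; exists k.
have PT : P = [set: T].
  apply: cT; first by exists b; left.
  - by exists P => //; rewrite setTI.
  - exists (~` Q); first exact: open_closedC.
    rewrite setTI; apply/seteqP; split => x; first by move=> Px /(PQ _ Px).
    by move=> nQ; case: (PQT x).
apply/seteqP; split => // x Ux.
have : P x by rewrite PT.
by case=> // -[k [Dk NkB] Nx]; apply: NB NkB _ _.
Qed.

(** Near a given point only finitely many members of the family matter, and a
finite union of closed sets is closed. *)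
Lemma closed_bigcup_locally_finite (I : Type) (D : set I) (F G : I -> set T) :
    locally_finite F -> (forall i, G i `<=` F i) ->
    (forall i, closed (G i)) ->
  closed (\bigcup_(i in D) G i).
Proof.
move=> lF GF cG x clx; have [N Nx finN] := lF x.
pose S := [set i | F i `&` N !=set0] `&` D.
suff [i [_ Di] Gx] : (\bigcup_(i in S) G i) x by exists i.
have finS : finite_set (S : set {classic I}) by exact: finite_setIl.
have := @closed_bigcup T {classic I} S G finS (fun i _ => cG i).
apply => B Bx; have [z [[i Di Gz] [Bz Nz]]] := clx _ (filterI Bx Nx).
by exists z; split => //; exists i => //; split => //; exists z; split => //; exact: GF.
Qed.

Lemma image_closure (T' : topologicalType) (f : T -> T') A :
  continuous f -> f @` closure A `<=` closure (f @` A).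
Proof.
move=> cf _ [x clx <-] B /cf Bx; have [z [Az Bz]] := clx _ Bx.
by exists (f z); split => //; exists z.
Qed.

End Topology.

(** * Row vectors with the supremum norm *)

Section Rows.
Variables (R : realType).

Lemma rV_normP (k : nat) (x : 'rV[R]_k) (e : R) : 0 <= e ->
  `|x| <= e <-> (forall i, `|x 0 i| <= e).
Proof.
move=> e0; rewrite [`|x|]/Num.norm/= mx_normrE; split=> [|H].
  move=> + i; apply: le_trans.
  by apply/bigmax_geP; right; exists (0, i).
by apply/bigmax_leP; split => // -[j i] _ /=; rewrite ord1.
Qed.

Lemma rV_ballP (k : nat) (x y : 'rV[R]_k) (e : R) :
  ball x e y <-> 0 < e /\ (forall i, `|x 0 i - y 0 i| < e).
Proof.
split=> [[e0 H]|[e0 H]]; split => //.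
  by move=> i; exact: H.
by move=> j i; rewrite ord1; exact: H.
Qed.

Lemma nonexpansive_continuous (k l : nat) (f : 'rV[R]_k -> 'rV[R]_l) :
    (forall x y e, ball x e y -> ball (f x) e (f y)) -> continuous f.
Proof.
move=> fxy x B /nbhs_ballP[e /= e0 eB]; apply/nbhs_ballP; exists e => // y.
by move=> /fxy; exact: eB.
Qed.

(** A segment between two points of the box stays in it coordinate by
coordinate. *)
Lemma connected_box (k : nat) (E : 'I_k -> set R) :
  (forall i, is_interval (E i)) ->
  connected [set x : 'rV[R]_k | forall i, E i (x 0 i)].
Proof.
move=> iE; set A := (A in connected A).
have [->|/set0P[x Ax]] := eqVneq A set0; first exact: connected0.
apply: (@connected_joined _ _ x) => y Ay.
pose f (t : R) : 'rV[R]_k := x + t *: (y - x).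
have cf : continuous f.
  move=> t; apply: cvgD; first exact: cvg_cst.
  by apply: cvgZr_tmp; exact: cvg_id.
exists (f @` `[0, 1]).
  split.
  - by exists 0; rewrite /f /= ?scale0r ?addr0// in_itv/= lexx ler01.
  - move=> _ [t /= + <-] i; rewrite in_itv /= => /andP[t0 t1].
    have := Ax i; have := Ay i; rewrite /f !mxE; move: (x 0 i) (y 0 i) => a b Eb Ea.
    have [ab|/ltW ba] := leP a b.
      apply: (iE i _ _ Ea Eb); nra.
    apply: (iE i _ _ Eb Ea); nra.
  - apply: connected_continuous_connected; first exact: segment_connected.
    exact: continuous_subspaceT.
exists 1; rewrite /f /= ?scale1r ?subrKC// in_itv/= lexx ler01//.
Qed.

End Rows.

(** * Removing cubes from R^m *)

Section Cubes.
Variables (R : realType) (m : nat).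
Implicit Types (x q : 'rV[R]_m) (r s : R).

(** The norm on row vectors is the supremum norm, so its balls are cubes. *)
Definition closed_cube q r : set 'rV[R]_m := closed_ball_ Num.norm q r.

Lemma closed_cubeP q r x : 0 <= r ->
  closed_cube q r x <-> forall i, `|q 0 i - x 0 i| <= r.
Proof.
move=> r0; apply: iff_trans (rV_normP _ r0) _.
by split=> H i; have := H i; rewrite !mxE.
Qed.

Lemma closed_cube_sub q r s : r < s -> closed_cube q r `<=` ball q s.
Proof.
by move=> rs x qx; rewrite -ball_normE /ball_/=; exact: le_lt_trans rs.
Qed.

Lemma ball_sub_closed_cube q r : ball q r `<=` closed_cube q r.
Proof. by move=> x; rewrite -ball_normE => /ltW. Qed.

Lemma connected_setT_rV : connected [set: 'rV[R]_m].
Proof.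
rewrite (_ : setT = [set x : 'rV[R]_m | forall i, [set: R] (x 0 i)]).
  by apply: (@connected_box _ _ (fun=> setT)).
by apply/seteqP; split.
Qed.

Lemma connected_ball q r : connected (ball q r).
Proof.
have [r0|r0] := ltP 0 r; last first.
  rewrite (_ : ball q r = set0); first exact: connected0.
  by apply/seteqP; split => // x [r0']; move: (lt_le_trans r0' r0); rewrite ltxx.
rewrite (_ : ball q r = [set x | forall i, [set a | `|q 0 i - a| < r] (x 0 i)]).
  apply: (@connected_box _ _ (fun i a => `|q 0 i - a| < r)) => i x y /=.
  rewrite !ltr_norml => /andP[a b] /andP[c d].
  by move=> z /andP[e f]; rewrite ltr_norml; apply/andP; split; lra.
apply/seteqP; split=> x /=; first by move=> /rV_ballP[].
by move=> H; apply/rV_ballP.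
Qed.

(** The shell is the union of the boxes [V i b] where the coordinate [i] exceeds
that of the center by more than [r] ([b = true]) or is below it by more than
[r].  The point [p0] on the diagonal lies in all the upper boxes; a lower box
[V i false] meets the upper box [V j true] for any [j] other than [i], which is
where two distinct indices are needed. *)
Lemma connected_annulus q r s (i0 i1 : 'I_m) : i0 != i1 -> 0 < r < s ->
  connected (ball q s `\` closed_cube q r).
Proof.
move=> i01 /andP[r0 rs].
have s0 : 0 < s by exact: lt_trans rs.
pose E i (b : bool) l := [set a : R | `|q 0 l - a| < s /\
  (l = i -> r < (if b then a - q 0 l else q 0 l - a))].
pose V i b := [set x : 'rV[R]_m | forall l, E i b l (x 0 l)].
have cV i b : connected (V i b).
  apply: (@connected_box _ _ (E i b)) => l x y [+ xi] [+ yi] z /andP[xz zy].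
  rewrite !ltr_norml => /andP[a1 a2] /andP[a3 a4]; split.
    by rewrite ltr_norml; apply/andP; split; lra.
  by move=> li; move: (xi li) (yi li); case: (b); lra.
have VA i b : V i b `<=` ball q s `\` closed_cube q r.
  move=> x Vx; split; first by apply/rV_ballP; split => // l; case: (Vx l).
  move=> /(closed_cubeP _ _ (ltW r0))/(_ i); case: (Vx i) => _ /(_ erefl).
  by rewrite ler_norml; case: b {Vx} => + /andP[]; lra.
pose c := (r + s) / 2.
pose p i : 'rV[R]_m := \row_l (if l == i then q 0 l - c else q 0 l + c).
pose p0 : 'rV[R]_m := \row_l (q 0 l + c).
have pV i j b : (if b then j != i else j == i) -> V j b (p i).
  move=> ji l; rewrite /E /= !mxE; split.
    by rewrite ltr_norml /c; case: ifP => _; apply/andP; split; lra.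
  by move=> lj; move: ji; rewrite lj; case: b; case: ifP => // _ _; rewrite /c; lra.
have p0V j : V j true p0.
  move=> l; rewrite /E /= !mxE; split; last by rewrite /c; lra.
  by rewrite ltr_norml /c; apply/andP; split; lra.
apply: (@connected_joined _ _ p0) => y [/rV_ballP[_ By] nCy].
have [i riy] : exists i, r < `|q 0 i - y 0 i|.
  apply: contrapT => /forallNP H; apply: nCy; apply/(closed_cubeP _ _ (ltW r0)).
  by move=> i; rewrite leNgt; apply/negP; exact: H.
move: riy; rewrite ltr_normr => /orP[riy|riy].
  have [j ji] : exists j, j != i.
    by have [->|] := eqVneq i i0; [exists i1; rewrite eq_sym|exists i0; rewrite eq_sym].
  apply: (connected_component_trans (y := p i)).
    exact: (joined_in (cV j true) (@VA _ _) (p0V j) (pV i j true ji)).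
  apply: (joined_in (cV i false) (@VA _ _) (pV i i false (eqxx i))).
  by move=> l; split; [exact: By|move=> ->].
apply: (joined_in (cV i true) (@VA _ _) (p0V i)).
by move=> l; split; [exact: By|move=> ->; rewrite -opprB].
Qed.

(** By [connected_fill], filling the cubes back in with the larger open cubes. *)
Lemma connected_setC_cubes (K : Type) (D : set K) (q : K -> 'rV[R]_m)
    (r s : K -> R) (i0 i1 : 'I_m) :
    i0 != i1 -> (forall k, 0 < r k < s k) ->
    trivIset D (fun k => ball (q k) (s k)) ->
    closed (\bigcup_(k in D) closed_cube (q k) (r k)) ->
  connected (~` \bigcup_(k in D) closed_cube (q k) (r k)).
Proof.
move=> i01 rs tN cl; apply: (connected_fill (D := D) _ _ _ tN).
- exact: connected_setT_rV.
- exact: closed_openC.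
- by move=> k _; apply: ball_open; have /andP[r0 /(lt_trans r0)] := rs k.
- move=> k Dk; rewrite (_ : _ `&` _ = ball (q k) (s k) `\` closed_cube (q k) (r k)).
    exact: connected_annulus i01 (rs k).
  apply/seteqP; split=> x [Nx nx]; split=> //.
    by move=> Cx; apply: nx; exists k.
  move=> [l Dl Cx]; have E : l = k.
    apply: tN => //; exists x; split=> //; apply: closed_cube_sub Cx.
    by have /andP[] := rs l.
  by apply: nx; rewrite -E.
- apply/seteqP; split=> // x _.
  have [[k Dk Cx]|] := pselect ((\bigcup_(k in D) closed_cube (q k) (r k)) x).
    by right; exists k => //; apply: closed_cube_sub Cx; have /andP[] := rs k.
  by left.
Qed.

Lemma closure_shift (A : set 'rV[R]_m) x v (d : R) : 0 < d -> `|v| <= 1 ->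
  (forall e, 0 < e < d -> A (x + e *: v)) -> closure A x.
Proof.
move=> d0 v1 H B /nbhs_ballP[e /= e0 eB].
pose c := Num.min d e / 2.
have mde : 0 < Num.min d e by rewrite lt_min d0 e0.
have md : Num.min d e <= d by rewrite ge_min lexx.
have me : Num.min d e <= e by rewrite ge_min lexx orbT.
exists (x + c *: v); split; first by apply: H; apply/andP; split; rewrite /c; lra.
apply: eB; rewrite -ball_normE /ball_ /= opprD addNKr normrN normrZ.
have c0 : 0 < c by rewrite /c; lra.
rewrite gtr0_norm //; apply: (@le_lt_trans _ _ c); last by rewrite /c; lra.
by rewrite ger_pMr.
Qed.

End Cubes.

(** * Cylinders over subsets of R^m *)

Section Cylinders.
Variables (R : realType) (m : nat).
Implicit Types (x : 'rV[R]_m) (y : 'rV[R]_(m + 1)) (A : set 'rV[R]_m) (J : set R).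

Definition height y : R := y 0 (rshift m 0).

Definition point_at x (t : R) : 'rV[R]_(m + 1) := row_mx x (const_mx t).

Definition cylinder A J : set 'rV[R]_(m + 1) :=
  [set y | A (lsubmx y) /\ J (height y)].

Lemma height_point_at x t : height (point_at x t) = t.
Proof. by rewrite /height row_mxEr mxE. Qed.

Lemma lsubmx_point_at x t : lsubmx (point_at x t) = x.
Proof. exact: row_mxKl. Qed.

Lemma point_atK y : point_at (lsubmx y) (height y) = y.
Proof.
rewrite -[RHS]hsubmxK /point_at; congr row_mx.
by apply/rowP => i; rewrite !mxE ord1.
Qed.

Lemma hyperplane_height y : hyperplane y <-> height y = 0.
Proof.
split=> [yH|y0].
  have : rsubmx y 0 0 = (0 : 'rV[R]_1) 0 0 by rewrite yH.
  by rewrite !mxE.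
by apply/rowP => i; rewrite !mxE ord1.
Qed.

Lemma to_hyperplaneE x : to_hyperplane x = point_at x 0.
Proof. by congr row_mx; apply/rowP => i; rewrite !mxE. Qed.

Lemma ball_point_at x x' t t' e :
  ball x e x' -> `|t - t'| < e -> ball (point_at x t) e (point_at x' t').
Proof.
move=> /rV_ballP[e0 xx'] tt'; apply/rV_ballP; split => // i.
rewrite -[i]splitK; case: (fintype.split i) => j /=; rewrite ?row_mxEl// !row_mxEr !mxE//.
Qed.

Lemma lsubmx_continuous : continuous (lsubmx : 'rV[R]_(m + 1) -> 'rV[R]_m).
Proof.
apply: nonexpansive_continuous => y y' e /rV_ballP[e0 H]; apply/rV_ballP.
by split => // i; rewrite !mxE.
Qed.

Lemma height_continuous : continuous height.
Proof. exact: coord_continuous. Qed.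

Lemma point_at_continuousl t : continuous (point_at^~ t).
Proof.
apply: nonexpansive_continuous => x y e xy; apply: ball_point_at => //.
by rewrite subrr normr0; case: xy.
Qed.

Lemma point_at_continuousr x : continuous (point_at x).
Proof.
move=> t B /nbhs_ballP[e /= e0 eB]; apply/nbhs_ballP; exists e => //= u tu.
by apply: eB; apply: ball_point_at => //; exact: ballxx.
Qed.

Lemma open_cylinder A J : open A -> open J -> open (cylinder A J).
Proof.
move=> oA oJ; apply: openI.
  by apply: open_comp oA => y _; exact: lsubmx_continuous.
by apply: open_comp oJ => y _; exact: height_continuous.
Qed.

Lemma cylinder_point_at A J x t : cylinder A J (point_at x t) <-> A x /\ J t.
Proof. by rewrite /cylinder /= lsubmx_point_at height_point_at. Qed.

Lemma connected_cylinder A J :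
  connected A -> is_interval J -> connected (cylinder A J).
Proof.
move=> cA /connected_intervalP cJ.
have [->|/set0P[x0 xJ]] := eqVneq (cylinder A J) set0; first exact: connected0.
apply: (@connected_joined _ _ x0) => y [Ay Jy]; case: xJ => Ax Jx.
rewrite -[x0]point_atK -[y]point_atK.
apply: (connected_component_trans (y := point_at (lsubmx y) (height x0))).
  exists (point_at^~ (height x0) @` A); last by exists (lsubmx y).
  split; first by exists (lsubmx x0).
    by move=> _ [z Az <-]; apply/cylinder_point_at.
  apply: connected_continuous_connected => //.
  exact/continuous_subspaceT/point_at_continuousl.
exists (point_at (lsubmx y) @` J); last by exists (height y).
split; first by exists (height x0).
  by move=> _ [z Az <-]; apply/cylinder_point_at.
apply: connected_continuous_connected => //.
exact/continuous_subspaceT/point_at_continuousr.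
Qed.

Lemma closure_cylinder A J x t :
  closure A x -> J t -> closure (cylinder A J) (point_at x t).
Proof.
move=> clx Jt; apply: (@closureS _ (point_at^~ t @` A)).
  by move=> _ [z Az <-]; apply/cylinder_point_at.
have := @image_closure _ _ _ A (@point_at_continuousl t); apply.
by exists x.
Qed.

Definition set_coord (i0 : 'I_m) (a : R) x : 'rV[R]_m :=
  \row_i (if i == i0 then a else x 0 i).

(** The parametrization of the vertical hyperplane where the coordinate [i0]
equals [a]: the coordinate [i0] of the parameter, which is free there, serves
as the height. *)
Definition wall_map i0 a x : 'rV[R]_(m + 1) :=
  point_at (set_coord i0 a x) (x 0 i0).

Lemma wall_map_continuous i0 a : continuous (wall_map i0 a).
Proof.
apply: nonexpansive_continuous => x x' e /rV_ballP[e0 xx'].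
apply: ball_point_at => //; apply/rV_ballP; split=> // i; rewrite !mxE.
by case: ifP => // _; rewrite subrr normr0.
Qed.

Lemma is_region_in_wall i0 a (w : 'rV[R]_m) (e : R) : 0 < e ->
  is_region_in m (wall_map i0 a @` closure (ball w e)).
Proof.
move=> e0; exists (ball w e), (wall_map i0 a),
  (fun y => set_coord i0 (height y) (lsubmx y)).
split=> //.
- split; [by exists w; exact: ballxx|exact: ball_open|exact: connected_ball].
- move=> x _; rewrite height_point_at lsubmx_point_at.
  by apply/rowP => i; rewrite !mxE; case: eqP => // ->.
- exact/continuous_subspaceT/wall_map_continuous.
- apply: continuous_subspaceT; apply: nonexpansive_continuous => y y' r.
  move=> /rV_ballP[r0 yy']; apply/rV_ballP; split=> // i; rewrite !mxE.
  by case: ifP => _; exact: yy'.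
Qed.

End Cylinders.

(** * The bodies of the colors *)

(** Cubes of radius [2 r] are placed at distance [4 r] from one another along
the diagonal of a cube contained in [U]; the factor [2] leaves a shell around
each cube of radius [r]. *)
Lemma exists_disjoint_cubes (R : realType) (m n : nat) (i0 : 'I_m)
    (U : set 'rV[R]_m) : U !=set0 -> open U ->
  exists (q : 'I_n -> 'rV[R]_m) (r : R), [/\ 0 < r,
    forall j, ball (q j) (2 * r) `<=` U
  & trivIset [set: 'I_n] (fun j => ball (q j) (2 * r))].
Proof.
move=> [p Up] oU.
have /nbhs_ballP[e /= e0 eU] : nbhs p U by exact: open_nbhs_nbhs.
pose r := e / (4 * n.+1%:R).
have r0 : 0 < r by rewrite divr_gt0 // mulr_gt0 // ltr0n.
have er : e = 4 * r * n.+1%:R.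
  by rewrite /r mulrAC mulrCA mulfV ?mulr1// mulf_neq0// pnatr_eq0.
clearbody r.
exists (fun j => p + const_mx (4 * r * j%:R)), r; split => // [j x|j k _ _ [x]].
  move=> /rV_ballP[_ H]; apply: eU; apply/rV_ballP; split=> // i.
  have := H i; rewrite !mxE !ltr_norml er.
  have : j%:R + 1 <= n%:R :> R by rewrite natr1 ler_nat.
  have : 0 <= j%:R :> R by rewrite ler0n.
  rewrite -(natr1 n); move: (j%:R) (n%:R) => a b a0 ab /andP[h1 h2].
  have ra : 0 <= r * a by apply: mulr_ge0 => //; exact: ltW.
  have rab : r * (a + 1) <= r * b by rewrite ler_pM2l.
  by apply/andP; split; lra.
case=> /rV_ballP[_ /(_ i0)] + /rV_ballP[_ /(_ i0)].
rewrite !mxE !ltr_norml => /andP[h1 h2] /andP[h3 h4].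
have lejk (a b : nat) : (a < b)%N -> 4 * r * b%:R - 4 * r * a%:R >= 4 * r.
  move=> ab; have : a%:R + 1 <= b%:R :> R by rewrite natr1 ler_nat.
  by nra.
by apply/val_inj; case: (ltngtP j k) => [/lejk jk|/lejk jk|//]; exfalso; lra.
Qed.

Section Construction.
Variables (R : realType) (m n : nat) (i0 i1 : 'I_m) (i01 : i0 != i1).
Variables (I : Type) (M : I -> set 'rV[R]_m) (c : I -> 'I_n).
(* [q r j] is the center of the cube of color [j] in the region [r], and [rho r]
   the common radius of the cubes of [r]; the doubled cubes provide the room
   around them. *)
Variables (q : I -> 'I_n -> 'rV[R]_m) (rho : I -> R).
Hypotheses (oM : forall r, open (M r)) (cM : forall r, connected (M r)).
Hypothesis tM : trivIset [set: I] M.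
Hypothesis lfM : locally_finite (fun r => closure (M r)).
Hypothesis rho0 : forall r, 0 < rho r.
Hypothesis qM : forall r j, ball (q r j) (2 * rho r) `<=` M r.
Hypothesis tq : forall r, trivIset [set: 'I_n] (fun j => ball (q r j) (2 * rho r)).

Let rho2 r : rho r < 2 * rho r.
Proof. by have := rho0 r; lra. Qed.

Lemma cubes_trivIset :
  trivIset [set: I * 'I_n] (fun k => ball (q k.1 k.2) (2 * rho k.1)).
Proof.
move=> [r j] [s k] _ _ [x [/= xr xs]].
have E : r = s by apply: tM => //; exists x; split; apply: qM; eassumption.
rewrite -{}E in xs *; congr (_, _).
by apply: (tq (r := r)) => //; exists x.
Qed.

Lemma q_eq r j s k x :
  ball (q r j) (2 * rho r) x -> ball (q s k) (2 * rho s) x -> (r, j) = (s, k).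
Proof. by move=> xr xs; apply: cubes_trivIset => //; exists x. Qed.

Lemma cube_in r j x : closed_cube (q r j) (rho r) x -> ball (q r j) (2 * rho r) x.
Proof. by move=> Cx; apply: closed_cube_sub Cx. Qed.

Lemma tube_in r j x : ball (q r j) (rho r) x -> ball (q r j) (2 * rho r) x.
Proof. by move=> /ball_sub_closed_cube/cube_in. Qed.

(** The traces in R^m of the tubes that cross layer [i]: those of lower colors
end below it, and the tubes of color [i] must stay in the body. *)
Definition obstacles (i : 'I_n) : set 'rV[R]_m :=
  \bigcup_(k in [set k : I * 'I_n | (i < k.2)%N])
    closed_cube (q k.1 k.2) (rho k.1).

Definition base (i : 'I_n) : set 'rV[R]_(m + 1) :=
  cylinder (\bigcup_(r in [set r | c r = i]) M r) `]-1, 1[.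

(** The tube exists for every color [j] in every region, so that a color
without regions also has a tube crossing the layers of the lower colors. *)
Definition tube (r : I) (j : 'I_n) : set 'rV[R]_(m + 1) :=
  cylinder (ball (q r j) (rho r))
    `](if c r == j then 0 else 1), (j%:R + 2)[.

Definition layer (i : 'I_n) : set 'rV[R]_(m + 1) :=
  cylinder (~` obstacles i) `](i%:R + 1), (i%:R + 2)[.

Definition body (i : 'I_n) : set 'rV[R]_(m + 1) :=
  base i `|` \bigcup_r tube r i `|` layer i.

(** The cubes of one color are inscribed in the locally finite family of the
regions, and there are finitely many colors. *)
Lemma closed_obstacles i : closed (obstacles i).
Proof.
rewrite (_ : obstacles i = \bigcup_(j in [set j : 'I_n | (i < j)%N])
    \bigcup_(r in [set: I]) closed_cube (q r j) (rho r)).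
  apply: closed_bigcup; first exact: finite_finset.
  move=> j _; apply: (closed_bigcup_locally_finite lfM).
    by move=> r x /cube_in/qM; exact: subset_closure.
  by move=> r; exact: closed_closed_ball_.
apply/seteqP; split=> x [k].
  by move=> ik Cx; exists k.2 => //; exists k.1.
by move=> ik [r _ Cx]; exists (r, k).
Qed.

Lemma connected_setC_obstacles i : connected (~` obstacles i).
Proof.
apply: (@connected_setC_cubes _ _ _ _ _ (fun k => rho k.1)
  (fun k => 2 * rho k.1) i0 i1) => //.
- by move=> k; rewrite rho0 rho2.
- by apply: sub_trivIset cubes_trivIset.
- exact: closed_obstacles.
Qed.

Lemma open_body i : open (body i).
Proof.
apply: openU; first apply: openU.
- by apply: open_cylinder; [apply: bigcup_open => r _|].
- by apply: bigcup_open => r _; apply: open_cylinder => //; exact: ball_open.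
- by apply: open_cylinder => //; exact/closed_openC/closed_obstacles.
Qed.

Lemma center_free r i : ~ obstacles i (q r i).
Proof.
move=> [[s k] /= ik /cube_in Cx].
have [_ E] := q_eq (ballxx (q r i) (lt_trans (rho0 r) (rho2 r))) Cx.
by move: ik; rewrite E ltnn.
Qed.

Lemma center_layer r i : layer i (point_at (q r i) (i%:R + 3 / 2)).
Proof.
apply/cylinder_point_at; split; first exact: center_free.
by rewrite /= in_itv /=; apply/andP; split; lra.
Qed.

(** All of the body is joined to a point of the layer: a tube crosses the layer
above its center, and a slab of color [i] is joined to the layer by the tube
rooted in it. *)
Lemma connected_body i (r0 : I) : connected (body i).
Proof.
apply: (@connected_joined _ _ (point_at (q r0 i) (i%:R + 3 / 2))) => y.
have LY : layer i `<=` body i by move=> z; right.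
have TY r : tube r i `<=` body i by move=> z; left; right; exists r.
have cL : connected (layer i).
  apply: connected_cylinder; first exact: connected_setC_obstacles.
  exact: interval_is_interval.
have jL z : layer i z ->
    connected_component (body i) (point_at (q r0 i) (i%:R + 3 / 2)) z.
  by move=> Lz; apply: (joined_in cL LY) => //; exact: center_layer.
have jT r z : tube r i z ->
    connected_component (body i) (point_at (q r0 i) (i%:R + 3 / 2)) z.
  move=> Tz; apply: connected_component_trans (jL _ (center_layer r i)) _.
  apply: (joined_in _ (TY r)) => //.
    by apply: connected_cylinder; [exact: connected_ball|exact: interval_is_interval].
  apply/cylinder_point_at; split; first exact: ballxx.
  rewrite /= in_itv /=; have : 0 <= i%:R :> R by exact: ler0n.
  by case: ifP => _ ?; apply/andP; split; lra.
move=> [[[[r cr Mr] hy]|[r _ /jT//]]|/jL//].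
have qq : M r (q r i) by apply: qM (ballxx _ _); exact: lt_trans (rho2 r).
apply: connected_component_trans (jT r (point_at (q r i) (1 / 2)) _) _.
  apply/cylinder_point_at; split; first exact: ballxx.
  rewrite /= in_itv /= cr eqxx; have : 0 <= i%:R :> R by exact: ler0n.
  by move=> ?; apply/andP; split; lra.
apply: (joined_in (B := cylinder (M r) `]-1, 1[)).
- by apply: connected_cylinder => //; exact: interval_is_interval.
- by move=> z [Mz hz]; left; left; split => //; exists r.
- apply/cylinder_point_at; split => //.
  by rewrite /= in_itv /=; apply/andP; split; lra.
- by [].
Qed.

Lemma region_color i x r : M r x -> (\bigcup_(s in [set s | c s = i]) M s) x -> c r = i.
Proof.
move=> Mx [s <- Ms]; congr c; apply: tM => //.
by exists x.
Qed.

Lemma tube_color r j y : tube r j y -> height y < 1 -> c r = j.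
Proof.
move=> [_] /=; rewrite in_itv /=; case: eqP => // _ /andP[h1 _] h2.
by move: (lt_trans h1 h2); rewrite ltxx.
Qed.

Lemma tube_region r j y : tube r j y -> M r (lsubmx y).
Proof. by move=> [/tube_in/qM]. Qed.

Lemma base_height i y : base i y -> height y < 1.
Proof. by move=> [_] /=; rewrite in_itv /= => /andP[]. Qed.

Lemma layer_height i y : layer i y -> i%:R + 1 < height y < i%:R + 2.
Proof. by move=> [_] /=; rewrite in_itv. Qed.

Lemma layer_height_gt1 i y : layer i y -> 1 < height y.
Proof.
move=> /layer_height/andP[h _]; apply: le_lt_trans h.
by rewrite lerDr ler0n.
Qed.

Lemma base_tube i r j y : base i y -> tube r j y -> i = j.
Proof.
move=> By Ty; have [] := By => By' _; rewrite -(tube_color Ty (base_height By)).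
by rewrite (region_color (tube_region Ty) By').
Qed.

Lemma base_layer i j y : base i y -> ~ layer j y.
Proof.
move=> /base_height h1 /layer_height_gt1 h2.
by move: (lt_trans h1 h2); rewrite ltxx.
Qed.

Lemma layer_ceil (i j : 'I_n) y : layer i y -> height y < j%:R + 2 -> (i <= j)%N.
Proof.
move=> /layer_height/andP[h1 _] h2; rewrite leqNgt; apply/negP => ji.
have : j%:R + 1 <= i%:R :> R by rewrite natr1 ler_nat.
lra.
Qed.

(** The slabs are separated by the disjointness of the regions, the layers by
their heights, and a tube can meet only the layers of colors below its own,
from which it has been removed. *)
Lemma trivIset_body : trivIset [set: 'I_n] body.
Proof.
move=> i j _ _ [y [Yi Yj]].
wlog ij : i j Yi Yj / (i <= j)%N.
  by move=> H; case/orP: (leq_total i j) => ij; [|symmetry]; apply: H.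
case: Yi => [[Bi|[r _ Ti]]|Li]; case: Yj => [[Bj|[s _ Tj]]|Lj].
- case: Bj => -[s <- Ms] _; case: Bi => Bi _.
  by rewrite (region_color Ms Bi).
- exact: base_tube Bi Tj.
- by case: (base_layer Bi Lj).
- by symmetry; exact: base_tube Bj Ti.
- case: Ti Tj => /tube_in qi _ [/tube_in qj _].
  by case: (q_eq qi qj).
- apply/val_inj/eqP; rewrite /= eqn_leq ij; apply: (layer_ceil Lj).
  by case: Ti => _ /=; rewrite in_itv /= => /andP[].
- by case: (base_layer Bj Li).
- apply: contrapT => /eqP nij; case: Li => + _; apply.
  exists (s, j); first by rewrite /= ltn_neqAle ij andbT.
  by case: Tj => /ball_sub_closed_cube.
- apply/val_inj/eqP; rewrite /= eqn_leq ij; apply: (layer_ceil Lj).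
  by case/andP: (layer_height Li).
Qed.

(** Moving by [e] across the wall of a tube only affects the distance to its
center along the coordinate [i0]. *)
Let wall_point r j (x : 'rV[R]_m) (e : R) : - rho r < e < rho r ->
  forall i, `|q r j 0 i - (set_coord i0 (q r j 0 i0 + rho r) x + e *: delta_mx 0 i0) 0 i|
     = if i == i0 then rho r + e else `|q r j 0 i - x 0 i|.
Proof.
move=> /andP[e1 e2] i; rewrite !mxE eqxx /=; case: eqP => [->|_] /=.
  by rewrite mulr1 -addrA opprD addNKr normrN ger0_norm //; lra.
by rewrite mulr0 addr0.
Qed.

Lemma norm_delta : `|delta_mx 0 i0 : 'rV[R]_m| <= 1.
Proof.
apply/(rV_normP _ ler01) => i; rewrite !mxE /=.
by case: eqP => _; rewrite ?normr1 ?normr0.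
Qed.

Lemma wall_tube_side r j (x : 'rV[R]_m) :
  (forall i, i != i0 -> `|q r j 0 i - x 0 i| < rho r) ->
  closure (ball (q r j) (rho r)) (set_coord i0 (q r j 0 i0 + rho r) x).
Proof.
move=> qx; apply: (@closure_shift _ _ _ _ (- delta_mx 0 i0) (rho r)) => //.
  by rewrite normrN norm_delta.
move=> e /andP[e0 er]; apply/rV_ballP; split => // i; rewrite scalerN -scaleNr.
rewrite wall_point; last by apply/andP; split; lra.
by case: ifPn => [_|/qx//]; lra.
Qed.

(** Just outside the wall a point is still in the doubled cube of its own tube,
hence away from every other tube. *)
Lemma wall_layer_side r (i j : 'I_n) (x : 'rV[R]_m) : (i < j)%N ->
  (forall l, l != i0 -> `|q r j 0 l - x 0 l| < rho r) ->
  closure (~` obstacles i) (set_coord i0 (q r j 0 i0 + rho r) x).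
Proof.
move=> ij qx; apply: (@closure_shift _ _ _ _ (delta_mx 0 i0) (rho r)) => //.
  exact: norm_delta.
move=> e /andP[e0 er]; set z := _ + _.
have er' : - rho r < e < rho r by apply/andP; split; lra.
have zq l : `|q r j 0 l - z 0 l| = if l == i0 then rho r + e else `|q r j 0 l - x 0 l|.
  exact: wall_point.
have zb : ball (q r j) (2 * rho r) z.
  have r0 := rho0 r; apply/rV_ballP; split => [|l]; first lra.
  rewrite zq; case: ifPn => [_|/qx]; lra.
move=> [[s k] /= ik Cz].
have [E1 E2] := q_eq zb (cube_in Cz); subst s k.
move/(closed_cubeP _ _ (ltW (rho0 r)))/(_ i0): Cz.
by rewrite zq eqxx; lra.
Qed.

(** The wall piece is the image of a small cube centered at mid-height of layer
[i]; its radius [e] keeps it within the side of the tube and within the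
layer. *)
Lemma adjacent_body (r0 : I) (i j : 'I_n) : i != j -> Defs.adjacent (body i) (body j).
Proof.
wlog ij : i j / (i < j)%N.
  move=> H nij; have : (i < j)%N || (j < i)%N by rewrite -neq_ltn.
  case/orP => ij; first exact: H.
  have [S rS SS] : Defs.adjacent (body j) (body i) by apply: H; rewrite // eq_sym.
  by exists S => // x /SS[].
move=> _; pose a := q r0 j 0 i0 + rho r0.
pose w := set_coord i0 (i%:R + 3 / 2) (q r0 j).
pose e := Num.min (rho r0) (1 / 2).
have e0 : 0 < e by rewrite lt_min rho0 /=; lra.
have er : e <= rho r0 by rewrite ge_min lexx.
have e2 : e <= 1 / 2 by rewrite ge_min lexx orbT.
exists (wall_map i0 a @` closure (ball w e)).
  have -> : (m + 1).-1 = m by rewrite addn1.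
  exact: is_region_in_wall.
suff H x : ball w e x -> (closure (body i) `&` closure (body j)) (wall_map i0 a x).
  have sub k : wall_map i0 a @` ball w e `<=` closure (body k) ->
      wall_map i0 a @` closure (ball w e) `<=` closure (body k).
    move=> /closureS; rewrite -(closure_id (closure (body k))).1; last exact: closed_closure.
    apply: subset_trans; apply: image_closure; exact: wall_map_continuous.
  by rewrite subsetI; split; apply: sub => _ [x /H[Hi Hj] <-].
move=> /rV_ballP[_ wx].
have ht : i%:R + 1 < x 0 i0 < i%:R + 2.
  move: (wx i0); rewrite !mxE eqxx ltr_norml => /andP[h1 h2].
  by apply/andP; split; lra.
have qx l : l != i0 -> `|q r0 j 0 l - x 0 l| < rho r0.
  move=> /negPf li; move: (wx l); rewrite !mxE li => /lt_le_trans; exact.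
have ij' : i%:R + 1 <= j%:R :> R by rewrite natr1 ler_nat.
have i_ge0 : 0 <= i%:R :> R by exact: ler0n.
split.
- apply: (@closureS _ (layer i)); first by move=> y; right.
  apply: closure_cylinder; first exact: wall_layer_side.
  by rewrite /= in_itv.
- apply: (@closureS _ (tube r0 j)); first by move=> y; left; right; exists r0.
  apply: closure_cylinder; first exact: wall_tube_side.
  by rewrite /= in_itv /=; case/andP: ht; case: ifP => _ *; apply/andP; split; lra.
Qed.

(** At heights in [(-1, 1)] a tube of color [i] appears only over regions of
color [i], and layers do not appear, so there the body projects into the union
of the regions of color [i]. *)
Lemma closure_body_hyperplane i :
  closure (body i) `&` @hyperplane R m =
    @to_hyperplane R m @` (\bigcup_(r in [set r | c r = i]) closure (M r)).
Proof.
apply/seteqP; split=> [y [cly /hyperplane_height y0]|_ [x [r cr clx] <-]].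
  exists (lsubmx y); last by rewrite to_hyperplaneE -[RHS]point_atK y0.
  suff: closure (\bigcup_(r in [set r | c r = i]) closure (M r)) (lsubmx y).
    rewrite -(closure_id (\bigcup_(r in _) _)).1 //.
    by apply: (closed_bigcup_locally_finite lfM) => r; [|exact: closed_closure].
  move=> B By.
  have nB : nbhs y (lsubmx @^-1` B `&` @height R m @^-1` `]-1, 1[).
    apply: filterI; first exact: lsubmx_continuous.
    apply: height_continuous; rewrite y0; apply: open_nbhs_nbhs; split => //.
    by rewrite /= in_itv /= ltrN10 ltr01.
  have [z [Yz [Bz]]] := cly _ nB.
  rewrite /= in_itv /= => /andP[_ z1]; exists (lsubmx z); split => //.
  case: Yz => [[[[r cr Mz] _]|[r _ Tz]]|/layer_height_gt1/(lt_trans z1)].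
  - by exists r => //; exact: subset_closure.
  - exists r; first exact: tube_color Tz z1.
    exact/subset_closure/(tube_region Tz).
  - by rewrite ltxx.
rewrite to_hyperplaneE; split; last by apply/hyperplane_height; rewrite height_point_at.
apply: (@closureS _ (base i)); first by move=> y; left; left.
apply: closure_cylinder; last by rewrite /= in_itv /= ltrN10 ltr01.
by apply: closureS clx => z Mz; exists r.
Qed.

End Construction.

Theorem corollary3p2 (R : realType) (m n : nat) (hm : (3 <= m)%N)
    (hn : (0 < n)%N) (I : Type) (M : I -> set 'rV[R]_m) :
  is_map M -> colorable n M ->
  exists Y : 'I_n -> set 'rV[R]_(m + 1), is_K Y /\ cross_section M Y.
Proof.
move=> [regM tM coverM lfM] [c cP].
pose i0 : 'I_m := Ordinal (leq_trans (isT : 0 < 3)%N hm).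
pose i1 : 'I_m := Ordinal (leq_trans (isT : 1 < 3)%N hm).
have i01 : i0 != i1 by [].
have oM r : open (M r) by have [] := regM r.
have cM r : connected (M r) by have [] := regM r.
have [r0 _] : exists r0 : I, True.
  have : [set: 'rV[R]_m] 0 by [].
  by rewrite -coverM => -[r _ _]; exists r.
have /choice[f fP] r : exists f : ('I_n -> 'rV[R]_m) * R, [/\ 0 < f.2,
    forall j, ball (f.1 j) (2 * f.2) `<=` M r
  & trivIset [set: 'I_n] (fun j => ball (f.1 j) (2 * f.2))].
  have [M0 _ _] := regM r.
  by have [q [rho H]] := exists_disjoint_cubes n i0 M0 (oM r); exists (q, rho).
pose q r := (f r).1.
pose rho r := (f r).2.
have rho0 r : 0 < rho r by have [] := fP r.
have qM r j : ball (q r j) (2 * rho r) `<=` M r by case: (fP r) => _ + _; apply.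
have tq r : trivIset [set: 'I_n] (fun j => ball (q r j) (2 * rho r)).
  by have [] := fP r.
exists (body M c q rho); split.
  split=> [i||i j /eqP ij].
  - split.
    + exists (point_at (q r0 i) (i%:R + 3 / 2)); right.
      exact: (center_layer tM rho0 qM tq).
    + exact: open_body.
    + exact: (connected_body i01 cM _ _ _ _ _ r0).
  - exact: trivIset_body.
  - exact: (adjacent_body i0 _ _ _ _ _ r0).
exists c; split=> [i|r s rs crs /(cP r s rs)//].
exact: closure_body_hyperplane.
Qed.
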